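(* Let $P_1$ and $P_2$ be real constant coefficient ordinary differential operators of orders $n_1\ge 2$ and $n_2\ge 2$, and let $\Sigma(t_1,t_2)=\sigma_1(t_1)\otimes\sigma_2(t_2)$ be the associated surface in $\mathbb{R}^{n_1n_2}$, with Gauss curvature $K$ and Riemannian measure $g\,dt_1dt_2$. If all the roots of the characteristic polynomials $\mathcal{P}_1$ and $\mathcal{P}_2$ are simple and if the real roots are dominant, then there exist $\epsilon=\epsilon(\Sigma)>0$ and $C=C(\Sigma)>0$ such that for all $(t_1,t_2)\in\mathbb{R}^2$: (1) $|K(t_1,t_2)|\le C e^{-\epsilon\|(t_1,t_2)\|}$; (2) $g(t_1,t_2)\,|K(t_1,t_2)|\le Ce^{-\epsilon\|(t_1,t_2)\|}$; and moreover (3) $|K|[\Sigma]:=\int_{\mathbb{R}^2}|K|\,g\,dt_1dt_2<\infty$.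
   Context: For $i=1,2$ let $P_i(\phi)=\phi^{(n_i)}+c_{i,n_i-1}\phi^{(n_i-1)}+\dots+c_{i,0}\phi$ be a real constant coefficient ordinary differential operator of order $n_i\ge2$ with characteristic polynomial $\mathcal{P}_i(\lambda)=\lambda^{n_i}+c_{i,n_i-1}\lambda^{n_i-1}+\dots+c_{i,0}$ and set of complex roots $\mathcal{R}_i$. Assume all roots are simple. Write $\mathcal{R}_1=\{r_1,\dots,r_k,x_1\pm y_1\sqrt{-1},\dots,x_p\pm y_p\sqrt{-1}\}$ and $\mathcal{R}_2=\{s_1,\dots,s_\ell,z_1\pm w_1\sqrt{-1},\dots,z_q\pm w_q\sqrt{-1}\}$, where $r_1>\dots>r_k$ and $s_1>\dots>s_\ell$ are the real roots and $y_j,w_j>0$. Define $\sigma_1(t_1)=(e^{r_1t_1},\dots,e^{r_kt_1},e^{x_1t_1}\cos(y_1t_1),e^{x_1t_1}\sin(y_1t_1),\dots)\in\mathbb{R}^{n_1}$ and $\sigma_2(t_2)=(e^{s_1t_2},\dots,e^{s_\ell t_2},e^{z_1t_2}\cos(w_1t_2),e^{z_1t_2}\sin(w_1t_2),\dots)\in\mathbb{R}^{n_2}$. The surface is $\Sigma(t_1,t_2)=\sigma_1(t_1)\otimes\sigma_2(t_2)\in\mathbb{R}^{n_1}\otimes\mathbb{R}^{n_2}=\mathbb{R}^{n_1n_2}$, i.e. its coordinates are all products of a coordinate of $\sigma_1(t_1)$ with a coordinate of $\sigma_2(t_2)$; $\mathbb{R}^{n_1n_2}$ carries the standard Euclidean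 inner product. ''The real roots are dominant'' means: $r_1>0$ and $r_1>\Re(\mu)$ for all $\mu\in\mathcal{R}_1\setminus\{r_1\}$; $r_k<0$ and $r_k<\Re(\mu)$ for all $\mu\in\mathcal{R}_1\setminus\{r_k\}$; $s_1>0$ and $s_1>\Re(\mu)$ for all $\mu\in\mathcal{R}_2\setminus\{s_1\}$; $s_\ell<0$ and $s_\ell<\Re(\mu)$ for all $\mu\in\mathcal{R}_2\setminus\{s_\ell\}$. (Under these hypotheses $\Sigma$ is an immersion.) Here $g_{ij}=(\partial_{t_i}\Sigma,\partial_{t_j}\Sigma)$ and $g=\sqrt{g_{11}g_{22}-g_{12}^2}$ (so $g$ denotes the density of the Riemannian measure, not the determinant). Let $L_{ij}$ be the orthogonal projection of $\partial_{t_i}\partial_{t_j}\Sigma$ on the normal space of $\Sigma$; the Gauss curvature is $K=g^{-2}\{(L_{11},L_{22})-(L_{12},L_{12})\}$. *)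

(* Defs.v *)
From HB Require Import structures.
From mathcomp Require Import all_boot all_order all_algebra.
From mathcomp Require Import all_classical all_reals all_analysis.
From mathcomp Require Import measurable_realfun.
From mathcomp.real_closed Require Import complex mxtens.

Set Implicit Arguments.
Unset Strict Implicit.
Unset Printing Implicit Defensive.

Import Order.TTheory GRing.Theory Num.Theory.
Import numFieldNormedType.Exports.

Local Open Scope classical_set_scope.
Local Open Scope ring_scope.
Local Open Scope complex_scope.

Section CharacteristicRoots.
Variable R : realType.

(* The coefficients c_0, ..., c_(n-1) stand for the differential operator
   phi |-> phi^(n) + c_(n-1) phi^(n-1) + ... + c_0 phi. *)
Definition charac_poly n (c : 'I_n -> R) : {poly R} :=
  'X^n + \sum_(j < n) c j *: 'X^j.

Definition charac_polyC n (c : 'I_n -> R) : {poly R[i]} :=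
  map_poly (real_complex R) (charac_poly c).

Definition simple_roots n (c : 'I_n -> R) : Prop :=
  forall mu : R[i],
    root (charac_polyC c) mu -> mup mu (charac_polyC c) = 1%N.

(* [rs] lists the real roots in decreasing order; the pair (x, y) in [zs], with
   y > 0, stands for the two conjugate roots x + iy and x - iy. *)
Definition lists_roots n (c : 'I_n -> R) (rs : seq R)
    (zs : seq (R * R)) : Prop :=
  [/\ sorted >%R rs,
      uniq zs,
      (forall z, z \in zs -> 0 < z.2) &
      forall mu : R[i], root (charac_polyC c) mu <->
        (exists2 r, r \in rs & mu = r%:C) \/
        (exists2 z, z \in zs & mu = z.1 +i* z.2 \/ mu = z.1 -i* z.2)].

(* If [rs] is empty then both entries below are 0 and the condition is false. *)
Definition dominant_real_roots n (c : 'I_n -> R) (rs : seq R) : Prop :=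
  let r1 := rs`_0 in
  let rk := rs`_(size rs).-1 in
  [/\ 0 < r1,
      (forall mu : R[i],
         root (charac_polyC c) mu -> mu <> r1%:C -> complex.Re mu < r1),
      rk < 0 &
      (forall mu : R[i],
         root (charac_polyC c) mu -> mu <> rk%:C -> rk < complex.Re mu)].

Definition sigma_coords (rs : seq R) (zs : seq (R * R)) (t : R) : seq R :=
  [seq expR (r * t) | r <- rs] ++
  flatten [seq [:: expR (z.1 * t) * cos (z.2 * t);
                   expR (z.1 * t) * sin (z.2 * t)] | z <- zs].

(* When all roots are simple, [sigma_coords rs zs t] has length
   n = size rs + 2 * size zs, so no coordinate is dropped or padded here. *)
Definition sigma n (rs : seq R) (zs : seq (R * R)) (t : R) : 'rV[R]_n :=
  \row_(j < n) (sigma_coords rs zs t)`_j.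

(* [*t] is the Kronecker product: the coordinates are all the products of a
   coordinate of [sigma n1 rs1 zs1 t1] and a coordinate of
   [sigma n2 rs2 zs2 t2]. *)
Definition tensor_surface n1 n2 (rs1 : seq R) (zs1 : seq (R * R))
    (rs2 : seq R) (zs2 : seq (R * R)) (t1 t2 : R) : 'rV[R]_(n1 * n2) :=
  sigma n1 rs1 zs1 t1 *t sigma n2 rs2 zs2 t2.

End CharacteristicRoots.

Section SurfaceGeometry.
Variables (R : realType) (N : nat).
Implicit Types S : R -> R -> 'rV[R]_N.

Definition dotv (u v : 'rV[R]_N) : R := \sum_(j < N) u 0 j * v 0 j.

(* Partial derivative in the first ([false]) or second ([true]) variable. *)
Definition pd (i : bool) S (t1 t2 : R) : 'rV[R]_N :=
  if i then derive1 (fun s => S t1 s) t2 else derive1 (fun s => S s t2) t1.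

Definition gram S (i j : bool) (t1 t2 : R) : R :=
  dotv (pd i S t1 t2) (pd j S t1 t2).

(* Density of the Riemannian measure: the square root of the determinant of the
   first fundamental form. *)
Definition area_density S (t1 t2 : R) : R :=
  Num.sqrt (gram S false false t1 t2 * gram S true true t1 t2
            - gram S false true t1 t2 ^+ 2).

(* Subspaces are row spaces of square matrices. *)
Definition tangent_space S (t1 t2 : R) : 'M[R]_N :=
  <<col_mx (pd false S t1 t2) (pd true S t1 t2)>>%MS.

(* The row vectors u with u *m (tangent_space S t1 t2)^T = 0, that is, the
   orthogonal complement of the tangent space. *)
Definition normal_space S (t1 t2 : R) : 'M[R]_N :=
  kermx (tangent_space S t1 t2)^T.

(* The tangent and normal spaces are complementary, so this is the orthogonal
   projection of the second derivative onto the normal space. *)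
Definition second_form S (i j : bool) (t1 t2 : R) : 'rV[R]_N :=
  pd i (pd j S) t1 t2 *m proj_mx (normal_space S t1 t2) (tangent_space S t1 t2).

Definition gauss_curvature S (t1 t2 : R) : R :=
  area_density S t1 t2 ^- 2 *
  (dotv (second_form S false false t1 t2) (second_form S true true t1 t2)
   - dotv (second_form S false true t1 t2) (second_form S false true t1 t2)).

Definition abs_curvature_density S (t : R * R) : \bar R :=
  (`|gauss_curvature S t.1 t.2| * area_density S t.1 t.2)%:E.

Definition total_abs_curvature S : \bar R :=
  (\int[(@lebesgue_measure R \x @lebesgue_measure R)%E]_(t in setT)
     abs_curvature_density S t)%E.

End SurfaceGeometry.

Definition norm2 (R : realType) (t1 t2 : R) : R := Num.sqrt (t1 ^+ 2 + t2 ^+ 2).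

(* Main.v *)
(* Write a for a curve solving one of the equations, alpha = |a|^2, gamma = |a'|^2,
   beta = (a, a'), W = alpha gamma - beta^2 = |a /\ a'|^2 and
   E = (a /\ a', a'' /\ a'), with indices 1 and 2 for the two factors. Scalar
   products of tensors factor, and the Gauss equation collapses to
     K D^2 = alpha1 alpha2 E1 E2 - gamma1 gamma2 W1 W2,
     D = g^2 = alpha1 gamma1 alpha2 gamma2 - beta1^2 beta2^2.
   Since a' is the image of a under a constant linear map, |E| <= C W. With
   h(t) = e^(2 r_1 t) + e^(2 r_k t), dominance gives alpha ~ gamma ~ h and
   0 < W <= C h^2 e^(-eta |t|): every bivector coordinate involves at most one
   copy of the dominant root. As D >= W1 alpha2 gamma2 and D >= W2 alpha1 gamma1,
   we get D^2 >= c W1 W2 (h1 h2)^2, hence |K| <= C / (h1 h2) and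
   (g |K|)^4 = D^2 K^4 <= C W1 W2 / (h1 h2)^2, both exponentially small. *)
Require Import Defs.
From HB Require Import structures.
From mathcomp Require Import all_boot all_order all_algebra.
From mathcomp Require Import all_classical all_reals all_analysis.
From mathcomp Require Import measurable_realfun.
From mathcomp.real_closed Require Import complex mxtens.
From mathcomp Require Import ring lra.

Import Order.TTheory GRing.Theory Num.Theory.
Import numFieldNormedType.Exports.
Local Open Scope classical_set_scope.
Local Open Scope ring_scope.

Set Implicit Arguments.
Unset Strict Implicit.
Unset Printing Implicit Defensive.

(** * Normal projection and Gauss curvature *)

Section Dot.
Context {R : realType}.

Lemma dotvE N (u v : 'rV[R]_N) : dotv u v = (u *m v^T) 0 0.
Proof. by rewrite /dotv mxE; apply: eq_bigr => j _; rewrite mxE. Qed.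

Lemma dotvC N (u v : 'rV[R]_N) : dotv u v = dotv v u.
Proof. by apply: eq_bigr => j _; rewrite mulrC. Qed.

Lemma dotvBl N (u v w : 'rV[R]_N) : dotv (u - v) w = dotv u w - dotv v w.
Proof. by rewrite !dotvE mulmxBl !mxE. Qed.

Lemma dotvZl N k (u w : 'rV[R]_N) : dotv (k *: u) w = k * dotv u w.
Proof. by rewrite !dotvE -scalemxAl mxE. Qed.

Lemma dotvv_ge0 N (u : 'rV[R]_N) : 0 <= dotv u u.
Proof. by apply: sumr_ge0 => j _; rewrite -expr2 sqr_ge0. Qed.

Lemma dotvv_eq0 N (u : 'rV[R]_N) : dotv u u = 0 -> u = 0.
Proof.
move=> u0; apply/rowP => j; apply/eqP; rewrite mxE -sqrf_eq0 expr2.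
by move/psumr_eq0P: u0 => -> // k _; rewrite -expr2 sqr_ge0.
Qed.

Lemma dotv_tens m n (a c : 'rV[R]_m) (b d : 'rV[R]_n) :
  dotv (a *t b : 'rV_(m * n)) (c *t d : 'rV_(m * n)) = dotv a c * dotv b d.
Proof.
have /matrixP/(_ 0 0) : (a *t b) *m (c *t d)^T = (a *m c^T) *t (b *m d^T).
  by rewrite trmx_tens tensmx_mul.
rewrite [RHS]mxE !dotvE => ->.
(* Both factors are 1 by 1 matrices, so the indices delivered by [mxtens_unindex] do not matter. *)
have e (M : 'M[R]_1) i j : M i j = M 0 0 by rewrite (ord1 i) (ord1 j).
by congr (_ * _); apply: e.
Qed.

End Dot.

Section TangentProjection.
Context {R : realType} {N : nat}.
Implicit Types u v w : 'rV[R]_N.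

(** If w = x T and w T^T = 0 then |w|^2 = w T^T x^T = 0. This trivial intersection is what [proj_mx]
    requires. *)
Lemma ker_tr_capmx m (T : 'M[R]_(m, N)) : (kermx T^T :&: T = 0)%MS.
Proof.
apply/eqP/rowV0P => w; rewrite sub_capmx => /andP[/sub_kermxP wN /submxP[x wE]].
by apply: dotvv_eq0; rewrite dotvE {2}wE trmx_mul mulmxA wN mul0mx mxE.
Qed.

Lemma sub_ker_tr2 u v w : dotv w u = 0 -> dotv w v = 0 ->
  (w <= kermx (<<col_mx u v>>%MS)^T)%MS.
Proof.
move=> wu wv; apply/sub_kermxP.
have /submxP[x ->] : (<<col_mx u v>> <= col_mx u v)%MS by rewrite genmxE.
have wu0 : w *m u^T = 0 by apply/rowP => i; rewrite ord1 -dotvE wu mxE.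
have wv0 : w *m v^T = 0 by apply/rowP => i; rewrite ord1 -dotvE wv mxE.
by rewrite trmx_mul tr_col_mx mulmxA mul_mx_row wu0 wv0 row_mx0 mul0mx.
Qed.

Definition gram_det u v : R := dotv u u * dotv v v - dotv u v ^+ 2.

(* Cramer's rule for the coefficients of the tangential part. *)
Definition normal_part u v w : 'rV[R]_N :=
  w - ((dotv w u * dotv v v - dotv w v * dotv u v) / gram_det u v) *: u
    - ((dotv w v * dotv u u - dotv w u * dotv u v) / gram_det u v) *: v.

Lemma dotv_normal_partl u v w w' : dotv (normal_part u v w) w' =
  dotv w w'
    - ((dotv w u * dotv v v - dotv w v * dotv u v) / gram_det u v) * dotv u w'
    - ((dotv w v * dotv u u - dotv w u * dotv u v) / gram_det u v) * dotv v w'.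
Proof. by rewrite !dotvBl !dotvZl. Qed.

Lemma dotv_normal_part_tangent u v w : gram_det u v != 0 ->
  dotv (normal_part u v w) u = 0 /\ dotv (normal_part u v w) v = 0.
Proof.
rewrite !dotv_normal_partl (dotvC v u) /gram_det.
by move=> D0; split; field.
Qed.

(** Split w into [normal_part u v w] and a combination of u and v: the projection fixes the former
    and kills the latter. *)
Lemma proj_normal_part u v w : gram_det u v != 0 ->
  let T := <<col_mx u v>>%MS in w *m proj_mx (kermx T^T) T = normal_part u v w.
Proof.
move=> D0 T; have uT : (u <= T)%MS by rewrite genmxE -addsmxE addsmxSl.
have vT : (v <= T)%MS by rewrite genmxE -addsmxE addsmxSr.
have [nu nv] := dotv_normal_part_tangent w D0.
have nT : (w - normal_part u v w <= T)%MS.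
  rewrite /normal_part -addrA opprD addNKr opprD !opprK.
  by rewrite addmx_sub// scalemx_sub.
rewrite -[in LHS](subrK (normal_part u v w) w) mulmxDl.
rewrite proj_mx_0 ?ker_tr_capmx// add0r proj_mx_id ?ker_tr_capmx//.
exact: sub_ker_tr2.
Qed.

(** One factor is already normal, so the tangential corrections of the other drop out; hence only
    the first power of the determinant in the denominator. *)
Lemma dotv_normal_part u v w w' : gram_det u v != 0 ->
  dotv (normal_part u v w) (normal_part u v w') =
    dotv w w' - (dotv v v * dotv w u * dotv w' u
      + dotv u u * dotv w v * dotv w' v
      - dotv u v * (dotv w u * dotv w' v + dotv w v * dotv w' u)) / gram_det u v.
Proof.
move=> D0; have [nu nv] := dotv_normal_part_tangent w D0.
rewrite [in LHS]dotvC dotv_normal_partl ![dotv _ (normal_part _ _ _)]dotvC nu nv.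
rewrite !mulr0 !subr0 dotv_normal_partl.
by rewrite (dotvC u w') (dotvC v w'); move: D0; rewrite /gram_det => D0; field.
Qed.

End TangentProjection.

(** Positivity of the Gram determinant undoes the square root in [area_density] and makes Cramer's
    rule available for the projections. *)
Lemma gauss_curvatureE {R : realType} {N : nat} (S : R -> R -> 'rV[R]_N) t1 t2 :
  let u := pd false S t1 t2 in let v := pd true S t1 t2 in
  let L i j := normal_part u v (pd i (pd j S) t1 t2) in
  0 < gram_det u v ->
  gauss_curvature S t1 t2 =
    (dotv (L false false) (L true true) - dotv (L false true) (L false true))
      / gram_det u v.
Proof.
move=> u v L D0; have D_neq0 : gram_det u v != 0 by rewrite gt_eqF.
rewrite /gauss_curvature mulrC.
have -> : area_density S t1 t2 ^+ 2 = gram_det u v.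
  by rewrite sqr_sqrtr// ltW.
have LE i j : second_form S i j t1 t2 = L i j.
  exact: (proj_normal_part (pd i (pd j S) t1 t2) D_neq0).
by rewrite (LE false false) (LE true true) (LE false true).
Qed.

(** * Curvature of a tensor product of curves *)

Definition is_derive_row {R : realType} {n} (F F' : R -> 'rV[R]_n) : Prop :=
  forall (t : R) j, is_derive t (1 : R) (fun s => F s 0 j) (F' t 0 j).

Lemma derive1_mx {R : realType} m n (M : R -> 'M[R]_(m, n)) (dM : 'M[R]_(m, n)) (t : R) :
  (forall i j, is_derive t (1 : R) (fun s => M s i j) (dM i j)) -> derive1 M t = dM.
Proof.
move=> MdM; rewrite derive1E derive_mx; last first.
  by apply/derivable_mxP => i j; exact: ex_derive.
by apply/matrixP => i j; rewrite mxE derive_val.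
Qed.

Section TensorSurface.
Context {R : realType} {m n : nat}.

Definition tens_surface (F : R -> 'rV[R]_m) (G : R -> 'rV[R]_n) t1 t2 :
  'rV[R]_(m * n) := F t1 *t G t2.

Lemma tens_rowE (a : 'rV[R]_m) (b : 'rV[R]_n) i k :
  (a *t b : 'rV_(m * n)) i k =
    a 0 (mxtens_unindex k).1 * b 0 (mxtens_unindex k).2.
Proof.
have e p (M : 'rV[R]_p) x y : M x y = M 0 y by rewrite (ord1 x).
by rewrite mxE (e _ a) (e _ b).
Qed.

Lemma pd_tens_surfacel F F' G : is_derive_row F F' ->
  pd false (tens_surface F G) = tens_surface F' G.
Proof.
move=> dF; apply/funext => t1; apply/funext => t2.
apply: derive1_mx => i k.
have -> : (fun s => tens_surface F G s t2 i k) =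
    (fun s => G t2 0 (mxtens_unindex k).2 *: F s 0 (mxtens_unindex k).1).
  by apply/funext => s; rewrite tens_rowE mulrC.
have -> : tens_surface F' G t1 t2 i k =
    G t2 0 (mxtens_unindex k).2 *: F' t1 0 (mxtens_unindex k).1.
  by rewrite tens_rowE mulrC.
exact: is_deriveZ.
Qed.

Lemma pd_tens_surfacer F G G' : is_derive_row G G' ->
  pd true (tens_surface F G) = tens_surface F G'.
Proof.
move=> dG; apply/funext => t1; apply/funext => t2.
apply: derive1_mx => i k.
have -> : (fun s => tens_surface F G t1 s i k) =
    (fun s => F t1 0 (mxtens_unindex k).1 *: G s 0 (mxtens_unindex k).2).
  by apply/funext => s; rewrite tens_rowE.
have -> : tens_surface F G' t1 t2 i k =
    F t1 0 (mxtens_unindex k).1 *: G' t2 0 (mxtens_unindex k).2.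
  by rewrite tens_rowE.
exact: is_deriveZ.
Qed.

(* With [b], [c] the first two derivatives of a curve [a] this is the inner
   product of the bivectors a /\ b and c /\ b. *)
Definition bivector_dot k (a b c : 'rV[R]_k) : R :=
  dotv a c * dotv b b - dotv a b * dotv b c.

Lemma gram_det_tens (a a' : 'rV[R]_m) (b b' : 'rV[R]_n) :
  gram_det (a' *t b : 'rV_(m * n)) (a *t b' : 'rV_(m * n)) =
    dotv a a * dotv a' a' * (dotv b b * dotv b' b') -
    dotv a a' ^+ 2 * dotv b b' ^+ 2.
Proof.
by rewrite /gram_det !dotv_tens (dotvC a' a); ring.
Qed.

(** All partial derivatives are again pure tensors, so every scalar product in the Gauss equation
    factors and a rational identity remains. *)
Lemma gauss_curvature_tens F F' F'' G G' G'' t1 t2 :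
  is_derive_row F F' -> is_derive_row F' F'' ->
  is_derive_row G G' -> is_derive_row G' G'' ->
  let D := gram_det (F' t1 *t G t2 : 'rV_(m * n)) (F t1 *t G' t2 : 'rV_(m * n)) in
  0 < D ->
  gauss_curvature (tens_surface F G) t1 t2 =
    (dotv (F t1) (F t1) * dotv (G t2) (G t2)
       * bivector_dot (F t1) (F' t1) (F'' t1) * bivector_dot (G t2) (G' t2) (G'' t2)
     - dotv (F' t1) (F' t1) * dotv (G' t2) (G' t2)
       * gram_det (F t1) (F' t1) * gram_det (G t2) (G' t2)) / D ^+ 2.
Proof.
move=> dF dF' dG dG' D D0; rewrite gauss_curvatureE.
  rewrite (pd_tens_surfacer F dG) (pd_tens_surfacel G dF) (pd_tens_surfacer F dG')
    (pd_tens_surfacel G dF') (pd_tens_surfacel G' dF).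
  have D_neq0 : D != 0 by rewrite gt_eqF.
  rewrite !dotv_normal_part // -/D /tens_surface !dotv_tens.
  rewrite (dotvC (G' t2) (G t2)) (dotvC (F' t1) (F t1)) (dotvC (G'' t2) (G t2))
    (dotvC (G'' t2) (G' t2)).
  move: D_neq0; rewrite /D gram_det_tens /bivector_dot /gram_det.
  rewrite (dotvC (F'' t1) (F t1)) (dotvC (F'' t1)) => D0'; field.
  by rewrite exprMn.
by rewrite (pd_tens_surfacel G dF) (pd_tens_surfacer F dG).
Qed.

Lemma area_density_tens F F' G G' t1 t2 :
  is_derive_row F F' -> is_derive_row G G' ->
  area_density (tens_surface F G) t1 t2 = Num.sqrt
    (gram_det (F' t1 *t G t2 : 'rV_(m * n)) (F t1 *t G' t2 : 'rV_(m * n))).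
Proof.
move=> dF dG; rewrite /area_density /gram.
by rewrite (pd_tens_surfacel G dF) (pd_tens_surfacer F dG).
Qed.

End TensorSurface.

(** * Growth of a curve with dominant real exponents *)

(** Binet-Cauchy identity for a /\ b and c /\ d. Summing over all ordered pairs counts each bivector
    coordinate twice, whence the factor 2. *)
Lemma lagrange_identity {R : realType} {n} (a b c d : 'rV[R]_n) :
  2 * (dotv a c * dotv b d - dotv a d * dotv b c) =
  \sum_(i < n) \sum_(j < n)
    (a 0 i * b 0 j - a 0 j * b 0 i) * (c 0 i * d 0 j - c 0 j * d 0 i).
Proof.
have dd (u v w z : 'rV[R]_n) : dotv u v * dotv w z =
    \sum_(i < n) \sum_(j < n) u 0 i * v 0 i * (w 0 j * z 0 j).
  by rewrite /dotv mulr_suml; apply: eq_bigr => i _; rewrite mulr_sumr.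
rewrite mulr2n mulrDl mul1r [in X in _ + X](mulrC (dotv a c)).
rewrite [in X in _ + X](mulrC (dotv a d)) !dd -!sumrB -big_split/=.
apply: eq_bigr => i _; rewrite -!sumrB -big_split/=.
by apply: eq_bigr => j _; ring.
Qed.

Lemma exists_gap {R : realType} (I : finType) (P : pred I) (g : I -> R) :
  (forall j, P j -> 0 < g j) -> exists2 eta, 0 < eta & forall j, P j -> eta <= g j.
Proof.
(* Starting the minimum at 1 keeps it positive even if no index satisfies [P]. *)
move=> g0; exists (\big[Num.min/1]_(j | P j) g j).
  by apply: lt_bigmin.
by move=> j Pj; apply: bigmin_le_cond.
Qed.

(** The interface between one curve and the surface: everything the curvature estimate uses about
    alpha, gamma, E, W and h of a factor. *)
Definition growth_bounds {R : realType} {n} (a a' a'' : R -> 'rV[R]_n)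
    (M eta : R) (h : R -> R) : Prop :=
  [/\ 1 <= M, 0 < eta & forall t,
    [/\ expR (eta * `|t|) <= h t /\ 0 < gram_det (a t) (a' t),
        h t <= M * dotv (a t) (a t) /\ dotv (a t) (a t) <= M * h t,
        h t <= M * dotv (a' t) (a' t) /\ dotv (a' t) (a' t) <= M * h t,
        `|bivector_dot (a t) (a' t) (a'' t)| <= M * gram_det (a t) (a' t) &
        gram_det (a t) (a' t) <= M * h t ^+ 2 * expR (- eta * `|t|)]].

Section DominatedCurve.
Context {R : realType} {n : nat}.
(** Abstract model of [sigma]: [e j] is the growth exponent of coordinate j, [k] swaps the cosine
    and sine of a conjugate pair, [x] and [y] are the coefficients of the linear system for a', and
    [p], [q] index the largest and the smallest root. *)
Variables (a : R -> 'rV[R]_n) (x y e : 'I_n -> R) (k : 'I_n -> 'I_n) (p q : 'I_n).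

Let a' t : 'rV[R]_n := \row_j (x j * a t 0 j + y j * a t 0 (k j)).
Let a'' t : 'rV[R]_n := \row_j (x j * a' t 0 j + y j * a' t 0 (k j)).

Hypothesis ek : forall j, e (k j) = e j.
Hypothesis a_le : forall t j, `|a t 0 j| <= expR (e j * t).
Hypothesis ap : forall t, a t 0 p = expR (e p * t).
Hypothesis aq : forall t, a t 0 q = expR (e q * t).
Hypothesis a'p : forall t, a' t 0 p = e p * a t 0 p.
Hypothesis a'q : forall t, a' t 0 q = e q * a t 0 q.
Hypothesis ep_gt0 : 0 < e p.
Hypothesis eq_lt0 : e q < 0.
Hypothesis lt_ep : forall j, j != p -> e j < e p.
Hypothesis gt_eq : forall j, j != q -> e q < e j.

Let B := \sum_j (`|x j| + `|y j|).

Let B_ge0 : 0 <= B. Proof. by apply: sumr_ge0 => j _; rewrite addr_ge0. Qed.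

Let xB j : `|x j| <= B.
Proof.
rewrite /B (bigD1 j)//= -addrA lerDl addr_ge0//.
by apply: sumr_ge0 => i _; rewrite addr_ge0.
Qed.

Let yB j : `|y j| <= B.
Proof.
rewrite /B (bigD1 j)//= -addrA addrCA lerDl addr_ge0//.
by apply: sumr_ge0 => i _; rewrite addr_ge0.
Qed.

Let a'_le t j : `|a' t 0 j| <= 2 * B * expR (e j * t).
Proof.
rewrite mxE (le_trans (ler_normD _ _))// !normrM -mulrA mulr2n mulrDl mul1r.
by rewrite lerD// ler_pM// -(ek j).
Qed.

(** Coordinates of the bivector a /\ a'. *)
Let w i j t := a t 0 i * a' t 0 j - a t 0 j * a' t 0 i.

Let le_h t j : expR (e j * t) <= expR (e p * t) + expR (e q * t).
Proof.
have [t0|t0] := leP 0 t.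
  rewrite (le_trans _ (_ : expR (e p * t) <= _)) ?lerDl ?expR_ge0// ler_expR.
  by rewrite ler_wpM2r//; have [->//|/lt_ep/ltW] := eqVneq j p.
rewrite (le_trans _ (_ : expR (e q * t) <= _)) ?lerDr ?expR_ge0// ler_expR.
by rewrite ler_wnM2r ?(ltW t0)//; have [->//|/gt_eq/ltW] := eqVneq j q.
Qed.

Let gram_detE t : 2 * gram_det (a t) (a' t) = \sum_i \sum_j w i j t ^+ 2.
Proof.
rewrite /gram_det expr2 {2}(dotvC (a t) (a' t)) lagrange_identity.
by apply: eq_bigr => i _; apply: eq_bigr => j _; rewrite expr2.
Qed.

Let w_le_gram i j t : w i j t ^+ 2 <= 2 * gram_det (a t) (a' t).
Proof.
rewrite gram_detE (bigD1 i)//= (bigD1 j)//= -addrA lerDl addr_ge0//.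
  by apply: sumr_ge0 => l _; rewrite sqr_ge0.
by apply: sumr_ge0 => l _; apply: sumr_ge0 => l' _; rewrite sqr_ge0.
Qed.

(** One bivector coordinate suffices: at [p], [q] it equals (e q - e p) exp((e p + e q) t), which
    never vanishes. *)
Let gram_det_gt0 t : 0 < gram_det (a t) (a' t).
Proof.
have := w_le_gram p q t; rewrite -(pmulr_rgt0 _ (ltr0n R 2)); apply: lt_le_trans.
rewrite exprn_even_gt0//= /w a'p a'q ap aq.
set X := expR _; set Y := expR _.
have -> : X * (e q * Y) - Y * (e p * X) = (e q - e p) * (X * Y) by ring.
by rewrite !mulf_neq0 ?(gt_eqF (expR_gt0 _))// lt_eqF// subr_lt0 (lt_trans eq_lt0).
Qed.

(* The derivative of a is the image of a under a constant linear map, so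
   a' /\ a'' is the image of a /\ a' under its second exterior power. *)
Let w'E i j t : a' t 0 i * a'' t 0 j - a' t 0 j * a'' t 0 i =
  x i * x j * w i j t + x i * y j * w i (k j) t
  + y i * x j * w (k i) j t + y i * y j * w (k i) (k j) t.
Proof. by rewrite /w !mxE; ring. Qed.

(** Each of the four terms in [w'E] is at most B^2 sqrt(2 W); squaring their sum gives 16 B^4. *)
Let w'_le i j t : (a' t 0 i * a'' t 0 j - a' t 0 j * a'' t 0 i) ^+ 2 <=
  16 * B ^+ 4 * (2 * gram_det (a t) (a' t)).
Proof.
set G := 2 * _; have wG i' j' : `|w i' j' t| <= Num.sqrt G.
  by rewrite -sqrtr_sqr ler_wsqrtr.
have cw c c' u : `|c| <= B -> `|c'| <= B -> `|u| <= Num.sqrt G ->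
    `|c * c' * u| <= B * B * Num.sqrt G.
  by move=> cB c'B uG; rewrite !normrM !ler_pM// mulr_ge0.
have G0 : 0 <= G by rewrite mulr_ge0// ltW.
have -> : 16 * B ^+ 4 * G = (4 * (B * B * Num.sqrt G)) ^+ 2.
  by rewrite !exprMn sqr_sqrtr//; ring.
rewrite w'E -[leLHS]real_normK ?num_real// ler_sqr ?nnegrE ?mulr_ge0 ?sqrtr_ge0//.
set u1 := x i * _ * _; set u2 := x i * _ * _; set u3 := y i * _ * _.
set u4 := y i * _ * _.
have := ler_normD (u1 + u2 + u3) u4; have := ler_normD (u1 + u2) u3.
have := ler_normD u1 u2; have := cw _ _ _ (xB i) (xB j) (wG i j).
have := cw _ _ _ (xB i) (yB j) (wG i (k j)).
have := cw _ _ _ (yB i) (xB j) (wG (k i) j).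
have := cw _ _ _ (yB i) (yB j) (wG (k i) (k j)).
rewrite -/u1 -/u2 -/u3 -/u4; lra.
Qed.

Let bivector_dot_le t : `|bivector_dot (a t) (a' t) (a'' t)| <=
  n%:R ^+ 2 * (1 + 16 * B ^+ 4) * gram_det (a t) (a' t).
Proof.
set G := gram_det _ _.
suff : `|2 * bivector_dot (a t) (a' t) (a'' t)| <=
    \sum_(i < n) \sum_(j < n) (1 + 16 * B ^+ 4) * (2 * G).
  rewrite !sumr_const !card_ord -mulrnA normrM (ger0_norm (ler0n R 2)).
  rewrite -[leRHS]mulr_natl natrM => H.
  by rewrite -(ler_pM2l (ltr0n R 2)) (le_trans H)//; lra.
rewrite /bivector_dot lagrange_identity (le_trans (ler_norm_sum _ _ _))//.
apply: ler_sum => i _; rewrite (le_trans (ler_norm_sum _ _ _))//.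
apply: ler_sum => j _; rewrite normrM mulrDl mul1r.
have := w_le_gram i j t; have := w'_le i j t; rewrite -/G /w.
set u := _ - _ :> R; set v := _ - _ :> R => u2 v2.
rewrite (le_trans _ (lerD v2 u2))//.
(* [bivector_dot] involves a'' /\ a', opposite in sign to a' /\ a'' of [w'_le]. The product is then
   bounded by |u| |v| <= u^2 + v^2. *)
have -> : `|a'' t 0 i * a' t 0 j - a'' t 0 j * a' t 0 i| = `|u|.
  by rewrite /u distrC; congr `|_|; ring.
rewrite -[u ^+ 2]real_normK ?num_real// -[v ^+ 2]real_normK ?num_real//.
have := sqr_ge0 (`|u| - `|v|); have := normr_ge0 u; have := normr_ge0 v; nra.
Qed.

Let h t := expR (e p * t) ^+ 2 + expR (e q * t) ^+ 2.

Let h_ge0 t : 0 <= h t. Proof. by rewrite addr_ge0// sqr_ge0. Qed.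

Let sqr_le_h t j c : 0 <= c -> forall z, `|z| <= c * expR (e j * t) ->
  z ^+ 2 <= 2 * c ^+ 2 * h t.
Proof.
move=> c0 z zc; have := le_h t j; rewrite /h.
have := expR_ge0 (e p * t); have := expR_ge0 (e q * t).
set u := expR (e p * t); set v := expR (e q * t) => v0 u0 uv.
have zuv : `|z| <= c * (u + v) by rewrite (le_trans zc)// ler_wpM2l.
rewrite -[z ^+ 2]real_normK ?num_real//.
rewrite (@le_trans _ _ ((c * (u + v)) ^+ 2))//.
  by rewrite lerXn2r// nnegrE mulr_ge0// addr_ge0.
(* The factor 2 comes from (u + v)^2 <= 2 (u^2 + v^2), whose defect is (u - v)^2. *)
have := sqr_ge0 (c * (u - v)); nra.
Qed.

Let dotv_le_h (b : 'rV[R]_n) t c : 0 <= c ->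
  (forall j, `|b 0 j| <= c * expR (e j * t)) -> dotv b b <= n%:R * (2 * c ^+ 2) * h t.
Proof.
move=> c0 bc; rewrite -mulrA mulr_natl -[n in leRHS]card_ord -sumr_const.
by apply: ler_sum => j _; rewrite -expr2 (sqr_le_h c0 (bc j)).
Qed.

Let sqr_le_dotv (b : 'rV[R]_n) j : b 0 j ^+ 2 <= dotv b b.
Proof.
rewrite /dotv (bigD1 j)//= expr2 lerDl.
by apply: sumr_ge0 => i _; rewrite -expr2 sqr_ge0.
Qed.

Let h_le_dotv t : h t <= 2 * dotv (a t) (a t).
Proof.
have := sqr_le_dotv (a t) p; have := sqr_le_dotv (a t) q.
by rewrite ap aq /h; lra.
Qed.

(** The coordinates [p] and [q] of a' are those of a times the nonzero factors e p and e q. *)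
Let h_le_dotv' t : h t <= (e p ^- 2 + e q ^- 2) * dotv (a' t) (a' t).
Proof.
have := sqr_le_dotv (a' t) p; have := sqr_le_dotv (a' t) q.
rewrite a'p a'q ap aq /h !exprMn mulrDl => H1 H2.
have ep2 : 0 < e p ^+ 2 by rewrite exprn_even_gt0//= gt_eqF.
have eq2 : 0 < e q ^+ 2 by rewrite exprn_even_gt0//= lt_eqF.
by apply: lerD; rewrite [leRHS]mulrC ler_pdivlMr// mulrC.
Qed.

Let gap : exists2 eta, 0 < eta &
  [/\ eta <= e p, eta <= - e q,
      forall j, j != p -> e j <= e p - eta &
      forall j, j != q -> e q + eta <= e j].
Proof.
(* At [p] and [q] the zero gap is replaced by the distance of the exponent from 0, which yields the
   first two bounds. *)
pose g j := Num.min (if j == p then e p else e p - e j)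
                    (if j == q then - e q else e j - e q).
have [|eta eta0 etaP] := @exists_gap R _ predT g.
  move=> j _; rewrite lt_min; apply/andP; split; case: eqVneq => [//|].
  - by move/lt_ep; rewrite subr_gt0.
  - by rewrite oppr_gt0.
  - by move/gt_eq; rewrite subr_gt0.
exists eta => //.
have {}etaP j : eta <= (if j == p then e p else e p - e j) /\
    eta <= (if j == q then - e q else e j - e q).
  by have := etaP j isT; rewrite le_min => /andP.
split.
- by have := (etaP p).1; rewrite eqxx.
- by have := (etaP q).2; rewrite eqxx.
- by move=> j jp; have := (etaP j).1; rewrite (negbTE jp); lra.
- by move=> j jq; have := (etaP j).2; rewrite (negbTE jq); lra.
Qed.

(** Distinct indices cannot both be dominant: e i + e j <= 2 e p - eta governs t >= 0, and e i + e j
    >= 2 e q + eta governs t < 0. The diagonal vanishes. *)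
Let w_decay eta t i j : 0 < eta ->
  (forall j, j != p -> e j <= e p - eta) ->
  (forall j, j != q -> e q + eta <= e j) ->
  w i j t ^+ 2 <= 16 * B ^+ 2 * (h t ^+ 2 * expR (- eta * `|t|)).
Proof.
move=> eta0 etap etaq.
have [->|ij] := eqVneq i j.
  by rewrite /w subrr expr0n/= !(mulr_ge0, exprn_ge0, expR_ge0)// h_ge0.
have wB : `|w i j t| <= 4 * B * expR ((e i + e j) * t).
  rewrite (le_trans (ler_normB _ _))// !normrM (mulrDl (e i)) expRD.
  have := ler_pM (normr_ge0 _) (normr_ge0 _) (a_le t i) (a'_le t j).
  have := ler_pM (normr_ge0 _) (normr_ge0 _) (a_le t j) (a'_le t i).
  lra.
have eh : expR ((e i + e j) * t) ^+ 2 <= h t ^+ 2 * expR (- eta * `|t|).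
  (* Here u will be e p t or e q t. Squaring produces exp(- 2 eta |t|), of which one factor exp(-
     eta |t|) is given away. *)
  have step u : expR u ^+ 2 <= h t ->
      (e i + e j) * t <= 2 * u - eta * `|t| ->
      expR ((e i + e j) * t) ^+ 2 <= h t ^+ 2 * expR (- eta * `|t|).
    move=> uh le_u.
    rewrite (@le_trans _ _ (expR (2 * u - eta * `|t|) ^+ 2))//.
      by rewrite lerXn2r ?nnegrE ?expR_ge0// ler_expR.
    rewrite (@le_trans _ _ ((expR u ^+ 2) ^+ 2 * expR (- eta * `|t|)))//.
      rewrite -!expRM_natl -expRD ler_expR.
      have : 0 <= eta * `|t| by rewrite mulr_ge0// ltW.
      lra.
    by rewrite ler_wpM2r ?expR_ge0// lerXn2r ?nnegrE ?exprn_ge0 ?expR_ge0.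
  have [t0|t0] := leP 0 t.
    apply: (step (e p * t)); first by rewrite lerDl sqr_ge0.
    rewrite ger0_norm// mulrA -mulrBl ler_wpM2r//.
    have := etap i; have := etap j; move: ij.
    have [->|_] := eqVneq i p; have [->|_] := eqVneq j p => //.
    - by move=> _ /(_ isT) H _; lra.
    - by move=> _ _ /(_ isT) H; lra.
    - by move=> _ /(_ isT) H1 /(_ isT) H2; lra.
  apply: (step (e q * t)); first by rewrite lerDr sqr_ge0.
  rewrite ltr0_norm// mulrN opprK mulrA -mulrDl ler_wnM2r ?(ltW t0)//.
  have := etaq i; have := etaq j; move: ij.
  have [->|_] := eqVneq i q; have [->|_] := eqVneq j q => //.
  - by move=> _ /(_ isT) H _; lra.
  - by move=> _ _ /(_ isT) H; lra.
  - by move=> _ /(_ isT) H1 /(_ isT) H2; lra.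
rewrite -[leLHS]real_normK ?num_real//.
rewrite (@le_trans _ _ ((4 * B * expR ((e i + e j) * t)) ^+ 2))//.
  by rewrite lerXn2r// nnegrE !mulr_ge0// expR_ge0.
have := ler_wpM2l (sqr_ge0 (4 * B)) eh; rewrite -exprMn; lra.
Qed.

Lemma dominated_growth_bounds : exists M eta, growth_bounds a a' a'' M eta h.
Proof.
have [eta eta0 [etap etaq etap' etaq']] := gap.
(* [A] and [C] bound alpha and gamma from above, [Q] serves the lower bound of gamma, [E] and [W]
   the last two bounds. The 2 added to them in the witness covers the lower bound of alpha and 1 <=
   M. *)
pose C := n%:R * (2 * (2 * B) ^+ 2) : R.
pose E := n%:R ^+ 2 * (1 + 16 * B ^+ 4) : R.
pose Q := e p ^- 2 + e q ^- 2.
pose W := n%:R ^+ 2 * (16 * B ^+ 2) : R.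
pose A := n%:R * (2 * 1 ^+ 2) : R.
have C0 : 0 <= C by rewrite mulr_ge0// mulr_ge0// sqr_ge0.
have E0 : 0 <= E by rewrite mulr_ge0 ?exprn_ge0// addr_ge0// mulr_ge0// exprn_ge0.
have Q0 : 0 <= Q by rewrite addr_ge0// invr_ge0 sqr_ge0.
have W0 : 0 <= W by rewrite mulr_ge0 ?exprn_ge0// mulr_ge0// exprn_ge0.
have A0 : 0 <= A by rewrite mulr_ge0// mulr_ge0// sqr_ge0.
exists (2 + A + C + E + Q + W), eta; split => //; first lra.
have le_M c X (M := 2 + A + C + E + Q + W) Y :
    Y <= c * X -> 0 <= X -> c <= M -> Y <= M * X.
  by move=> cX X0 cM; rewrite (le_trans cX)// ler_wpM2r.
move=> t; split.
- split; last exact: gram_det_gt0.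
  have [t0|t0] := leP 0 t.
    rewrite (@le_trans _ _ (expR (e p * t) ^+ 2)) ?lerDl ?sqr_ge0//.
    rewrite -expRM_natl ler_expR ger0_norm// mulrA ler_wpM2r//; lra.
  rewrite (@le_trans _ _ (expR (e q * t) ^+ 2)) ?lerDr ?sqr_ge0//.
  rewrite -expRM_natl ler_expR ltr0_norm// mulrN -mulNr mulrA.
  by rewrite ler_wnM2r ?(ltW t0)//; lra.
- split; first by apply: le_M (h_le_dotv t) (dotvv_ge0 _) _; lra.
  apply: le_M (_ : _ <= A * h t) (h_ge0 t) _; last lra.
  by apply: dotv_le_h => // j; rewrite mul1r.
- split; first by apply: le_M (h_le_dotv' t) (dotvv_ge0 _) _; rewrite -/Q; lra.
  apply: le_M (_ : _ <= C * h t) (h_ge0 t) _; last lra.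
  by apply: dotv_le_h => //; rewrite mulr_ge0.
- by apply: le_M (bivector_dot_le t) (ltW (gram_det_gt0 t)) _; rewrite -/E; lra.
- rewrite -mulrA; apply: (le_M W); last lra.
    have G2 : gram_det (a t) (a' t) <= 2 * gram_det (a t) (a' t).
      by rewrite mulr2n mulrDl mul1r lerDl ltW.
    rewrite (le_trans G2)// gram_detE.
    have -> : W * (h t ^+ 2 * expR (- eta * `|t|)) = \sum_(i < n) \sum_(j < n)
        16 * B ^+ 2 * (h t ^+ 2 * expR (- eta * `|t|)).
      by rewrite !sumr_const !card_ord -mulrnA -[RHS]mulr_natl natrM /W; ring.
    by apply: ler_sum => i _; apply: ler_sum => j _; apply: w_decay.
  by rewrite mulr_ge0 ?expR_ge0// sqr_ge0.
Qed.

End DominatedCurve.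

(** * Decay of the curvature *)

Section CurvatureDecay.
Context {R : realType}.

(** Loosening the constants lets the two factors share one [M] and one [eta]. *)
Lemma growth_bounds_le n (a a' a'' : R -> 'rV[R]_n) M M' eta eta' h :
  M <= M' -> 0 < eta' -> eta' <= eta ->
  growth_bounds a a' a'' M eta h -> growth_bounds a a' a'' M' eta' h.
Proof.
move=> MM eta'0 eta_le [M1 eta0 H]; split=> //; first exact: le_trans MM.
move=> t; have [[he W0] [ha1 ha2] [hb1 hb2] hE hW] := H t.
have h0 : 0 <= h t by rewrite (le_trans _ he)// expR_ge0.
have le_M X : 0 <= X -> M * X <= M' * X by move=> X0; rewrite ler_wpM2r.
have le_eta : eta' * `|t| <= eta * `|t| by rewrite ler_wpM2r.
split.
- by split=> //; rewrite (le_trans _ he)// ler_expR.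
- by split; [apply: le_trans ha1 _|apply: le_trans ha2 _];
    rewrite le_M// dotvv_ge0.
- by split; [apply: le_trans hb1 _|apply: le_trans hb2 _];
    rewrite le_M// dotvv_ge0.
- by apply: le_trans hE _; rewrite le_M// ltW.
- apply: le_trans hW _; rewrite -mulrA -[leRHS]mulrA.
  have X0 : 0 <= h t ^+ 2 * expR (- eta * `|t|) by rewrite mulr_ge0 ?expR_ge0 ?sqr_ge0.
  rewrite (le_trans (le_M _ X0))//.
  have M'0 : 0 <= M' by rewrite (le_trans _ MM)// (le_trans _ M1).
  rewrite (ler_wpM2l M'0)//.
  by rewrite ler_wpM2l ?sqr_ge0// ler_expR !mulNr lerN2.
Qed.

(** D = W1 alpha2 gamma2 + beta1^2 W2 = W2 alpha1 gamma1 + beta2^2 W1. Dropping the second summand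
    of each form and multiplying the two lower bounds gives the claim. *)
Lemma gram_det_tens_lower (al1 be1 ga1 al2 be2 ga2 h1 h2 M : R)
    (F1 := al1 * ga1 - be1 ^+ 2) (F2 := al2 * ga2 - be2 ^+ 2)
    (D := al1 * ga1 * (al2 * ga2) - be1 ^+ 2 * be2 ^+ 2) :
  0 < M -> 0 < h1 -> 0 < h2 -> 0 < F1 -> 0 < F2 ->
  h1 <= M * al1 -> h1 <= M * ga1 -> h2 <= M * al2 -> h2 <= M * ga2 ->
  F1 * F2 * (h1 * h2) ^+ 2 <= M ^+ 4 * D ^+ 2.
Proof.
move=> M0 h10 h20 F10 F20 ha1 hg1 ha2 hg2.
have sq (x y z : R) : 0 < x -> x <= M * y -> x <= M * z -> x ^+ 2 <= M ^+ 2 * (y * z).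
  move=> x0 xy xz; have -> : M ^+ 2 * (y * z) = (M * y) * (M * z) by ring.
  by rewrite expr2 ler_pM// ltW.
have key (f1 f2 b z x : R) : 0 < f1 -> 0 < f2 -> 0 < x ->
    x ^+ 2 <= M ^+ 2 * z -> f1 * x ^+ 2 <= M ^+ 2 * (f1 * z + b ^+ 2 * f2).
  move=> f10 f20 x0 xz; rewrite mulrDr -[leLHS]addr0 lerD//.
    by rewrite [leRHS]mulrCA ler_pM2l.
  by do 2!rewrite mulr_ge0 ?sqr_ge0//; rewrite ltW.
have D1 : F1 * h2 ^+ 2 <= M ^+ 2 * D.
  have -> : D = F1 * (al2 * ga2) + be1 ^+ 2 * F2 by rewrite /D /F1 /F2; ring.
  by apply: key => //; apply: sq.
have D2 : F2 * h1 ^+ 2 <= M ^+ 2 * D.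
  have -> : D = F2 * (al1 * ga1) + be2 ^+ 2 * F1 by rewrite /D /F1 /F2; ring.
  by apply: key => //; apply: sq.
have -> : F1 * F2 * (h1 * h2) ^+ 2 = (F1 * h2 ^+ 2) * (F2 * h1 ^+ 2) by ring.
have -> : M ^+ 4 * D ^+ 2 = (M ^+ 2 * D) * (M ^+ 2 * D) by ring.
by rewrite ler_pM// mulr_ge0 ?sqr_ge0// ltW.
Qed.

Lemma curvature_numerator_le (al1 ga1 E1 F1 al2 ga2 E2 F2 h1 h2 M : R) :
  1 <= M -> 0 < F1 -> 0 < F2 ->
  0 <= al1 <= M * h1 -> 0 <= ga1 <= M * h1 ->
  0 <= al2 <= M * h2 -> 0 <= ga2 <= M * h2 ->
  `|E1| <= M * F1 -> `|E2| <= M * F2 ->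
  `|al1 * al2 * E1 * E2 - ga1 * ga2 * F1 * F2| <=
    2 * M ^+ 4 * (h1 * h2) * (F1 * F2).
Proof.
move=> M1 F10 F20 /andP[a10 a1] /andP[g10 g1] /andP[a20 a2] /andP[g20 g2] E1M E2M.
have M0 : 0 <= M by exact: le_trans M1.
have F0 : 0 <= F1 * F2 by rewrite mulr_ge0// ltW.
have H0 : 0 <= M ^+ 2 * (h1 * h2).
  have -> : M ^+ 2 * (h1 * h2) = (M * h1) * (M * h2) by ring.
  exact: mulr_ge0 (le_trans a10 a1) (le_trans a20 a2).
have aa : al1 * al2 <= M ^+ 2 * (h1 * h2).
  by apply: le_trans (ler_pM a10 a20 a1 a2) _; lra.
have gg : ga1 * ga2 <= M ^+ 2 * (h1 * h2).
  by apply: le_trans (ler_pM g10 g20 g1 g2) _; lra.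
have EE : `|E1| * `|E2| <= M ^+ 2 * (F1 * F2).
  rewrite (le_trans (ler_pM _ _ E1M E2M))//; lra.
have t1 : `|al1 * al2 * E1 * E2| <= M ^+ 4 * (h1 * h2) * (F1 * F2).
  rewrite !normrM (ger0_norm a10) (ger0_norm a20) -mulrA.
  have -> : M ^+ 4 * (h1 * h2) * (F1 * F2) = (M ^+ 2 * (h1 * h2)) * (M ^+ 2 * (F1 * F2)).
    by ring.
  by rewrite ler_pM// mulr_ge0.
(* This term only produces M^2; 1 <= M raises it to the M^4 of the other one. *)
have t2 : `|ga1 * ga2 * F1 * F2| <= M ^+ 4 * (h1 * h2) * (F1 * F2).
  rewrite -mulrA normrM (ger0_norm F0) normrM (ger0_norm g10) (ger0_norm g20).
  rewrite ler_wpM2r//; apply: le_trans gg _.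
  have -> : M ^+ 4 * (h1 * h2) = M ^+ 2 * (M ^+ 2 * (h1 * h2)) by ring.
  by rewrite ler_peMl// exprn_ege1.
by rewrite (le_trans (ler_normB _ _))//; lra.
Qed.

(** Here F is W1 W2 and H is h1 h2. The fourth power removes the root and leaves |X|^4 / D^6; since
    F^4 H^4 = F (F H^2)^3 / H^2, the hypothesis cubed cancels D^6. *)
Lemma curvature_quotient_le (X D F H M : R) :
  0 < M -> 0 < D -> 0 < F -> 0 < H ->
  F * H ^+ 2 <= M ^+ 4 * D ^+ 2 -> `|X| <= 2 * M ^+ 4 * H * F ->
  `|X / D ^+ 2| <= 2 * M ^+ 8 / H /\
  (Num.sqrt D * `|X / D ^+ 2|) ^+ 4 <= 16 * M ^+ 28 * (F / H ^+ 2).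
Proof.
move=> M0 D0 F0 H0 FH XF.
have D20 : 0 < D ^+ 2 by rewrite exprn_gt0.
have D60 : 0 < D ^+ 6 by rewrite exprn_gt0.
have absE : `|X / D ^+ 2| = `|X| / D ^+ 2 by rewrite normrM normfV (ger0_norm (ltW D20)).
split.
  rewrite absE ler_pdivrMr// mulrAC ler_pdivlMr//.
  rewrite (le_trans (ler_wpM2r (ltW H0) XF))//.
  have -> : 2 * M ^+ 4 * H * F * H = 2 * M ^+ 4 * (F * H ^+ 2) by ring.
  have -> : 2 * M ^+ 8 * D ^+ 2 = 2 * M ^+ 4 * (M ^+ 4 * D ^+ 2) by ring.
  by rewrite ler_wpM2l// mulr_ge0// exprn_ge0// ltW.
have -> : (Num.sqrt D * `|X / D ^+ 2|) ^+ 4 = `|X| ^+ 4 / D ^+ 6.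
  rewrite exprMn (exprM _ 2 2) sqr_sqrtr ?ltW// absE.
  by field; rewrite gt_eqF.
rewrite ler_pdivrMr// mulrA mulrAC ler_pdivlMr ?exprn_gt0//.
have X4 : `|X| ^+ 4 <= (2 * M ^+ 4 * H * F) ^+ 4.
  by rewrite lerXn2r// nnegrE (le_trans _ XF).
rewrite (le_trans (ler_wpM2r _ X4)) ?exprn_ge0 ?(ltW H0)//.
have FH3 : (F * H ^+ 2) ^+ 3 <= (M ^+ 4 * D ^+ 2) ^+ 3.
  by rewrite lerXn2r// nnegrE mulr_ge0 ?exprn_ge0// ltW.
have -> : (2 * M ^+ 4 * H * F) ^+ 4 * H ^+ 2 =
  16 * M ^+ 16 * F * (F * H ^+ 2) ^+ 3 by ring.
have -> : 16 * M ^+ 28 * F * D ^+ 6 =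
  16 * M ^+ 16 * F * (M ^+ 4 * D ^+ 2) ^+ 3 by ring.
by rewrite ler_wpM2l// !mulr_ge0 ?exprn_ge0// ltW.
Qed.

(** * Exponential decay of K and g K for a tensor product of two curves *)

Section Tensor.
Context {m n : nat}.
Variables (F F' F'' : R -> 'rV[R]_m) (G G' G'' : R -> 'rV[R]_n).
Hypotheses (dF : is_derive_row F F') (dF' : is_derive_row F' F'').
Hypotheses (dG : is_derive_row G G') (dG' : is_derive_row G' G'').

(** D = W1 W2 + W1 beta2^2 + beta1^2 W2, with positive first summand. *)
Lemma tens_surface_gram_det_gt0 M1 M2 eta1 eta2 h1 h2 t1 t2 :
  growth_bounds F F' F'' M1 eta1 h1 -> growth_bounds G G' G'' M2 eta2 h2 ->
  0 < gram_det (F' t1 *t G t2 : 'rV_(m * n)) (F t1 *t G' t2 : 'rV_(m * n)).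
Proof.
move=> [M11 _ /(_ t1)[[_ W1] _ _ _ _]] [M21 _ /(_ t2)[[_ W2] _ _ _ _]].
rewrite gram_det_tens; move: W1 W2; rewrite /gram_det => W1 W2.
have := mulr_gt0 W1 W2.
have := mulr_ge0 (ltW W1) (sqr_ge0 (dotv (G t2) (G' t2))).
have := mulr_ge0 (sqr_ge0 (dotv (F t1) (F' t1))) (ltW W2).
lra.
Qed.

Lemma tens_surface_curvature_decay M1 M2 eta1 eta2 h1 h2 :
  growth_bounds F F' F'' M1 eta1 h1 -> growth_bounds G G' G'' M2 eta2 h2 ->
  exists eps C, [/\ 0 < eps, 0 < C & forall t1 t2,
    `|gauss_curvature (tens_surface F G) t1 t2| <=
      C * expR (- eps * (`|t1| + `|t2|)) /\
    area_density (tens_surface F G) t1 t2 *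
      `|gauss_curvature (tens_surface F G) t1 t2| <=
      C * expR (- eps * (`|t1| + `|t2|))].
Proof.
move=> HF HG; pose M := Num.max M1 M2; pose eta := Num.min eta1 eta2.
have M1_1 : 1 <= M1 by case: HF.
have M_1 : 1 <= M by rewrite le_max M1_1.
have M_gt0 : 0 < M by exact: lt_le_trans M_1.
have eta_gt0 : 0 < eta by rewrite lt_min; case: HF => _ ->; case: HG => _ ->.
have {}HF : growth_bounds F F' F'' M eta h1.
  by apply: growth_bounds_le HF => //; rewrite ?le_max ?ge_min lexx.
have {}HG : growth_bounds G G' G'' M eta h2.
  by apply: growth_bounds_le HG => //; rewrite ?le_max ?ge_min lexx orbT.
(* The quarter accounts for the fourth root in the bound of g |K|. There 16 M^28 times M^4 is the
   fourth power of 2 M^8, which is also the constant in the bound of |K|. *)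
exists (eta / 4), (2 * M ^+ 8); split.
- by rewrite divr_gt0.
- by rewrite mulr_gt0// exprn_gt0.
move=> t1 t2; rewrite (area_density_tens t1 t2 dF dG).
have D_gt0 := tens_surface_gram_det_gt0 t1 t2 HF HG.
rewrite (gauss_curvature_tens dF dF' dG dG' D_gt0).
case: HF => _ _ /(_ t1)[[h1e W1] [ha1 ah1] [hb1 bh1] E1 W1d].
case: HG => _ _ /(_ t2)[[h2e W2] [ha2 ah2] [hb2 bh2] E2 W2d].
have h10 : 0 < h1 t1 by exact: lt_le_trans (expR_gt0 _) h1e.
have h20 : 0 < h2 t2 by exact: lt_le_trans (expR_gt0 _) h2e.
have lower := gram_det_tens_lower M_gt0 h10 h20 W1 W2 ha1 hb1 ha2 hb2.
rewrite -gram_det_tens in lower.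
have := @curvature_numerator_le _ _ _ _ _ _ _ _ (h1 t1) (h2 t2) M M_1 W1 W2.
move=> /(_ (dotv (F t1) (F t1)) (dotv (F' t1) (F' t1))
  (bivector_dot (F t1) (F' t1) (F'' t1))).
move=> /(_ (dotv (G t2) (G t2)) (dotv (G' t2) (G' t2))
  (bivector_dot (G t2) (G' t2) (G'' t2))).
rewrite !dotvv_ge0 ah1 ah2 bh1 bh2 => /(_ isT isT isT isT E1 E2) upper.
have [K1 K2] := curvature_quotient_le M_gt0 D_gt0 (mulr_gt0 W1 W2)
  (mulr_gt0 h10 h20) lower upper.
set T := `|t1| + `|t2|; have T0 : 0 <= T by rewrite addr_ge0.
have etaT : eta * `|t1| + eta * `|t2| = eta * T by rewrite -mulrDr.
split.
  apply: le_trans K1 _; rewrite ler_wpM2l ?mulr_ge0 ?exprn_ge0 ?(ltW M_gt0)//.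
  rewrite (@le_trans _ _ (expR (- (eta * T))))//.
    rewrite expRN lef_pV2 ?posrE ?expR_gt0 ?mulr_gt0// -etaT expRD.
    by rewrite ler_pM ?expR_ge0.
  rewrite ler_expR mulNr lerN2 ler_wpM2r// ler_pdivrMr//.
  by rewrite ler_peMr ?(ltW eta_gt0)// ler1n.
rewrite -(@ler_pXn2r _ 4)// ?nnegrE; last 2 first.
- by rewrite mulr_ge0// sqrtr_ge0.
- by rewrite !mulr_ge0 ?exprn_ge0 ?expR_ge0// ltW.
apply: le_trans K2 _.
have -> : (2 * M ^+ 8 * expR (- (eta / 4) * T)) ^+ 4 =
    16 * M ^+ 32 * expR (- (eta * T)).
  rewrite exprMn -expRM_natl (_ : 4 * _ = - (eta * T)); last by field.
  by ring.
have FH : gram_det (F t1) (F' t1) * gram_det (G t2) (G' t2) / (h1 t1 * h2 t2) ^+ 2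
    <= M ^+ 4 * expR (- (eta * T)).
  rewrite ler_pdivrMr ?exprn_gt0 ?mulr_gt0//.
  rewrite (le_trans (ler_pM (ltW W1) (ltW W2) W1d W2d))//.
  rewrite -etaT opprD expRD !mulNr.
  set x := expR _; set y := expR _.
  have -> : M * h1 t1 ^+ 2 * x * (M * h2 t2 ^+ 2 * y) =
    M ^+ 2 * (x * y * (h1 t1 * h2 t2) ^+ 2) by ring.
  have X0 : 0 <= x * y * (h1 t1 * h2 t2) ^+ 2.
    by rewrite mulr_ge0 ?sqr_ge0// mulr_ge0 ?expR_ge0.
  rewrite -[leRHS]mulrA (ler_wpM2r X0)//.
  by apply: ler_weXn2l.
have -> : 16 * M ^+ 32 * expR (- (eta * T)) =
  16 * M ^+ 28 * (M ^+ 4 * expR (- (eta * T))) by ring.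
by rewrite ler_wpM2l// mulr_ge0// exprn_ge0// ltW.
Qed.

End Tensor.
End CurvatureDecay.

(** * Coordinates of sigma and characteristic roots *)

Section Roots.
Context {R : realType}.
Local Open Scope complex_scope.
Variables (n : nat) (c : 'I_n -> R) (rs : seq R) (zs : seq (R * R)).
Hypothesis roots : lists_roots c rs zs.

Lemma size_charac_polyC : size (charac_polyC c) = n.+1.
Proof.
rewrite size_map_inj_poly ?rmorph0//; last exact: fmorph_inj.
rewrite /charac_poly size_polyDl size_polyXn// ltnS.
apply: (leq_trans (size_sum _ _ _)); apply/bigmax_leqP => j _.
by rewrite (leq_trans (size_scale_leq _ _))// size_polyXn.
Qed.

(** The listed numbers are distinct roots of a polynomial of degree n. Hence every listed root has
    its coordinates within ['I_n]. *)
Lemma size_lists_roots : (size rs + (size zs).*2 <= n)%N.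
Proof.
have [srs uzs zs0 rootP] := roots.
pose L := [seq r%:C | r <- rs] ++
  [seq z.1 +i* z.2 | z <- zs] ++ [seq z.1 -i* z.2 | z <- zs].
have -> : (size rs + (size zs).*2 = size L)%N.
  by rewrite !size_cat !size_map addnn.
rewrite -ltnS -size_charac_polyC; apply: max_poly_roots.
- by rewrite -size_poly_gt0 size_charac_polyC.
- apply/allP => mu; rewrite !mem_cat => /or3P[] /mapP[u us ->].
  + by apply/rootP; left; exists u.
  + by apply/rootP; right; exists u => //; left.
  + by apply/rootP; right; exists u => //; right.
have inj1 : injective (fun z : R * R => z.1 +i* z.2) by move=> [? ?] [? ?] [-> ->].
have inj2 : injective (fun z : R * R => z.1 -i* z.2).
  by move=> [? ?] [? ?] [->] /oppr_inj ->.
rewrite !cat_uniq !map_inj_uniq//; last by move=> u v [].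
rewrite uzs (sorted_uniq _ _ srs); [|exact: rev_trans lt_trans|exact: ltxx].
(* The three families are disjoint by the sign of the imaginary part. *)
rewrite /= andbT; apply/andP; split.
  apply/hasPn => mu; rewrite mem_cat => /orP[] /mapP[z /zs0 z0 ->];
    by apply/mapP => -[r _] [_ zr]; lra.
apply/hasPn => mu /mapP[z /zs0 z0 ->].
by apply/mapP => -[z' /zs0 z'0] [_ zr]; lra.
Qed.

End Roots.

(** * The linear differential system satisfied by the coordinates *)

Lemma is_derive_comp_scale {R : realType} (f : R -> R) (u t df : R) :
  is_derive (u * t) 1 f df -> is_derive t 1 (fun s => f (u * s)) (u * df).
Proof.
move=> fdf; have ut : is_derive t (1 : R) ( *%R u) u.
  by rewrite -[X in is_derive _ _ _ X]mulr1; exact: (is_deriveZ u (is_derive_id t 1)).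
by rewrite mulrC; exact: (is_derive1_comp fdf ut).
Qed.

Section SigmaCoords.
Context {R : realType}.
Variables (rs : seq R) (zs : seq (R * R)).

Lemma nth_flatten_pairs (f g : R * R -> R) (i : nat) :
  nth 0 (flatten [seq [:: f z; g z] | z <- zs]) i =
  if (i./2 < size zs)%N then (if odd i then g else f) (nth (0, 0) zs i./2) else 0.
Proof.
elim: zs i => [|z l IH] [|[|i]] //=.
by rewrite IH negbK.
Qed.

(* For a coordinate [j] beyond the real roots, [pair_of j] is the complex root
   it belongs to ([(0, 0)] for a padding coordinate); cosines have even and sines
   odd offset [j - size rs]. *)
Definition pair_of (j : nat) : R * R := nth (0, 0) zs (j - size rs)./2.

Definition re_of (j : nat) : R := if (j < size rs)%N then rs`_j else (pair_of j).1.

(** The sign is that of a rotation: the derivative of cos(v t) is - v sin(v t), that of sin(v t) is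
    v cos(v t). *)
Definition im_of (j : nat) : R := if (j < size rs)%N then 0 else
  if odd (j - size rs) then (pair_of j).2 else - (pair_of j).2.

Definition conj_of (j : nat) : nat := if (j < size rs)%N then j else
  if odd (j - size rs) then j.-1 else j.+1.

Lemma nth_sigma_coords t j : (sigma_coords rs zs t)`_j =
  if (j < size rs)%N then expR (rs`_j * t) else
  if ((j - size rs)./2 < size zs)%N then expR (re_of j * t) *
    (if odd (j - size rs) then sin ((pair_of j).2 * t) else cos ((pair_of j).2 * t))
  else 0.
Proof.
rewrite /sigma_coords nth_cat size_map /re_of; case: ltnP => jr.
  by rewrite (nth_map 0).
by rewrite nth_flatten_pairs /pair_of; case: odd.
Qed.

Lemma conj_of_half j : ~~ (j < size rs)%N ->
  [/\ ~~ (conj_of j < size rs)%N, (conj_of j - size rs)./2 = (j - size rs)./2 &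
      odd (conj_of j - size rs) = ~~ odd (j - size rs)].
Proof.
move=> jr; rewrite /conj_of (negbTE jr); move: jr; rewrite -leqNgt => jr.
have [i ->] : exists i, j = (i + size rs)%N by exists (j - size rs)%N; rewrite subnK.
rewrite addnK; case: ifPn => oi.
  case: i oi => // i; rewrite addSn/= addnK => oi.
  by rewrite -leqNgt leq_addl uphalf_half (negbTE oi).
by rewrite -addSn addnK/= -leqNgt leq_addl uphalf_half (negbTE oi).
Qed.

Lemma re_of_conj j : re_of (conj_of j) = re_of j.
Proof.
have [jr|jr] := boolP (j < size rs)%N; first by rewrite /conj_of jr.
have [kr kj _] := conj_of_half jr.
by rewrite /re_of (negbTE kr) (negbTE jr) /pair_of kj.
Qed.

Lemma sigma_coords_le t j :
  `|(sigma_coords rs zs t)`_j| <= expR (re_of j * t).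
Proof.
rewrite nth_sigma_coords /re_of; case: ifPn => jr; first by rewrite ger0_norm ?expR_ge0.
case: ifPn => jz; last by rewrite normr0 expR_ge0.
rewrite (negbTE jr) normrM ger0_norm ?expR_ge0// ler_piMr ?expR_ge0//.
by case: ifP => _; rewrite ler_norml ?sin_geN1 ?sin_le1 ?cos_geN1 ?cos_le1.
Qed.

Lemma is_derive_sigma_coords (t : R) j :
  is_derive t (1 : R) (fun s => (sigma_coords rs zs s)`_j)
    (re_of j * (sigma_coords rs zs t)`_j
      + im_of j * (sigma_coords rs zs t)`_(conj_of j)).
Proof.
under eq_fun do rewrite nth_sigma_coords.
rewrite !nth_sigma_coords /re_of /im_of.
have [jr|jr] := boolP (j < size rs)%N.
  by rewrite mul0r addr0; exact: is_derive_comp_scale.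
have [kr kj ko] := conj_of_half jr.
rewrite (negbTE kr) kj ko /pair_of kj -/(pair_of j).
(* The partner of a padding coordinate is padding too, as both have the same halved offset;
   everything is then 0. *)
case: ifPn => jz; last by rewrite !mulr0 addr0; exact: is_derive_cst.
set u := (pair_of j).1; set v := (pair_of j).2.
have de : is_derive t (1 : R) (fun s => expR (u * s)) (u * expR (u * t)).
  exact: is_derive_comp_scale.
have ds : is_derive t (1 : R) (fun s => sin (v * s)) (v * cos (v * t)).
  exact: is_derive_comp_scale.
have dc : is_derive t (1 : R) (fun s => cos (v * s)) (v * - sin (v * t)).
  exact: is_derive_comp_scale.
case: ifPn => oj /=.
  by apply: (is_derive_eq (is_deriveM de ds)); rewrite /GRing.scale/=; ring.
by apply: (is_derive_eq (is_deriveM de dc)); rewrite /GRing.scale/=; ring.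
Qed.

End SigmaCoords.

Lemma is_derive_row_comb {R : realType} n (x y : 'I_n -> R) (k : 'I_n -> 'I_n)
    (a a' : R -> 'rV[R]_n) : is_derive_row a a' ->
  is_derive_row (fun t => \row_j (x j * a t 0 j + y j * a t 0 (k j)))
                (fun t => \row_j (x j * a' t 0 j + y j * a' t 0 (k j))).
Proof.
move=> da t j; rewrite mxE; under eq_fun do rewrite mxE.
exact: (is_deriveD (is_deriveZ (x j) (da t j)) (is_deriveZ (y j) (da t (k j)))).
Qed.

Lemma sigma_growth_bounds {R : realType} n (c : 'I_n -> R) (rs : seq R)
    (zs : seq (R * R)) :
  lists_roots c rs zs -> dominant_real_roots c rs ->
  exists a' a'' a''' M eta h, [/\ is_derive_row (sigma n rs zs) a',
    is_derive_row a' a'', is_derive_row a'' a''' &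
    growth_bounds (sigma n rs zs) a' a'' M eta h].
Proof.
move=> roots [r1_gt0 r1P rk_lt0 rkP].
have := size_lists_roots roots; have [srs _ zs_gt0 rootP] := roots => size_n.
(* For an empty list the head would be the default 0, against r_1 > 0. *)
have rs_gt0 : (0 < size rs)%N by case: (rs) r1_gt0 => //=; rewrite ltxx.
have p_n : (0 < n)%N by rewrite (leq_trans rs_gt0)// (leq_trans _ size_n)// leq_addr.
have q_rs : ((size rs).-1 < size rs)%N by rewrite prednK.
have q_n : ((size rs).-1 < n)%N.
  by rewrite (leq_trans q_rs)// (leq_trans _ size_n)// leq_addr.
pose p := Ordinal p_n; pose q := Ordinal q_n.
pose x (j : 'I_n) := re_of rs zs j; pose y (j : 'I_n) := im_of rs zs j.
pose k (j : 'I_n) : 'I_n := insubd j (conj_of rs j).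
(* [insubd] falls back to j when the partner lies outside ['I_n]. By the bound on the number of
   roots j is then a padding coordinate, with [y j] = 0, so the derivative formula survives. *)
have kP j : y j = 0 \/ val (k j) = conj_of rs j.
  rewrite val_insubd; case: ifPn => [_|kn]; [by right|left].
  rewrite /y /im_of; case: ifPn => // jr; have [kr kj _] := conj_of_half jr.
  rewrite /pair_of nth_default ?oppr0 ?if_same//= -kj.
  rewrite leqNgt; apply: contra kn => kz; apply: leq_trans size_n.
  move: kr; rewrite -leqNgt => kr; rewrite -ltn_subLR//.
  by rewrite -ltn_half_double.
have re_k j : x (k j) = x j.
  rewrite /x val_insubd; case: ifP => _ //; exact: re_of_conj.
pose a' t : 'rV[R]_n :=
  \row_j (x j * sigma n rs zs t 0 j + y j * sigma n rs zs t 0 (k j)).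
have da : is_derive_row (sigma n rs zs) a'.
  move=> t j; rewrite mxE; under eq_fun do rewrite mxE.
  rewrite !mxE -/(x j); have := is_derive_sigma_coords rs zs t j.
  rewrite -/(x j) -/(y j).
  by have [->|->//] := kP j; rewrite !mul0r.
have realE (j : 'I_n) : (j < size rs)%N ->
    [/\ forall t, sigma n rs zs t 0 j = expR (x j * t) &
        forall t, a' t 0 j = x j * sigma n rs zs t 0 j].
  move=> jr; split=> t; first by rewrite mxE nth_sigma_coords jr /x /re_of jr.
  by rewrite mxE /y /im_of jr mul0r addr0.
have [ap a'p] := realE p rs_gt0; have [aq a'q] := realE q q_rs.
have xp : x p = rs`_0 by rewrite /x /re_of rs_gt0.
have xq : x q = rs`_(size rs).-1 by rewrite /x /re_of q_rs.
have rs_lt i j : (i < j < size rs)%N -> rs`_j < rs`_i.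
  move=> /andP[ij jr]; apply: (sorted_ltn_nth _ 0 srs) => //.
    exact: rev_trans lt_trans.
  by rewrite inE (ltn_trans ij).
have between j : ~~ (j < size rs)%N -> rs`_(size rs).-1 < re_of rs zs j < rs`_0.
  move=> jr; rewrite /re_of (negbTE jr) /pair_of.
  (* A padding coordinate has exponent 0, strictly between r_k < 0 and r_1 > 0. *)
  have [jz|jz] := ltnP (j - size rs)./2 (size zs); last first.
    by rewrite (nth_default _ jz) rk_lt0 r1_gt0.
  set z := nth (0, 0) zs _; have zz : z \in zs by exact: mem_nth.
  have z_gt0 := zs_gt0 _ zz.
  have rz : root (charac_polyC c) (z.1 +i* z.2)%C.
    by apply/rootP; right; exists z => //; left.
  by rewrite (rkP _ rz) ?(r1P _ rz)//; case=> _ z0; rewrite z0 ltxx in z_gt0.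
have [M [eta H]] : exists M eta, growth_bounds (sigma n rs zs) a'
    (fun t => \row_j (x j * a' t 0 j + y j * a' t 0 (k j))) M eta
    (fun t => expR (x p * t) ^+ 2 + expR (x q * t) ^+ 2).
  apply: dominated_growth_bounds => //.
  - by move=> t j; rewrite mxE; exact: sigma_coords_le.
  - by rewrite xp.
  - by rewrite xq.
  - move=> j jp; rewrite xp /x; have [jr|jr] := boolP (j < size rs)%N.
      by rewrite /re_of jr rs_lt// jr andbT lt0n.
    by have /andP[] := between j jr.
  - move=> j jq; rewrite xq /x; have [jr|jr] := boolP (j < size rs)%N.
      rewrite /re_of jr rs_lt// q_rs andbT ltn_neqAle -ltnS prednK// jr andbT.
      exact: jq.
    by have /andP[] := between j jr.
(* Differentiation repeats the same linear map; the third derivative will give measurability of the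
   second. *)
have da' := is_derive_row_comb x y k da.
by do 6!eexists; split; [exact: da|exact: da'|exact: is_derive_row_comb da'|exact: H].
Qed.

(** * Measurability and integrability *)

Section Measurability.
Context {R : realType}.

Definition measurable_row {n} (a : R -> 'rV[R]_n) : Prop :=
  forall j, measurable_fun [set: R] (fun t => a t 0 j).

Lemma is_derive_row_measurable n (a a' : R -> 'rV[R]_n) :
  is_derive_row a a' -> measurable_row a.
Proof.
move=> da j; apply: continuous_measurable_fun => t.
exact/differentiable_continuous/derivable1_diffP/ex_derive.
Qed.

Lemma measurable_dotv n (a b : R -> 'rV[R]_n) : measurable_row a -> measurable_row b ->
  measurable_fun [set: R] (fun t => dotv (a t) (b t)).
Proof. by move=> ma mb; apply: measurable_sum => j; exact: measurable_funM. Qed.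

Lemma measurable_gram_det n (a b : R -> 'rV[R]_n) :
  measurable_row a -> measurable_row b ->
  measurable_fun [set: R] (fun t => gram_det (a t) (b t)).
Proof.
move=> ma mb; apply: measurable_funB.
  by apply: measurable_funM; exact: measurable_dotv.
by apply: measurable_funX; exact: measurable_dotv.
Qed.

Lemma measurable_bivector_dot n (a b c : R -> 'rV[R]_n) :
  measurable_row a -> measurable_row b -> measurable_row c ->
  measurable_fun [set: R] (fun t => bivector_dot (a t) (b t) (c t)).
Proof.
by move=> ma mb mc; apply: measurable_funB; apply: measurable_funM;
  exact: measurable_dotv.
Qed.

Lemma measurable_fun_inv_gt0 d (T : measurableType d) (f : T -> R) :
  (forall x, 0 < f x) -> measurable_fun [set: T] f ->
  measurable_fun [set: T] (fun x => (f x)^-1).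
Proof.
move=> f0 mf; rewrite (_ : (fun _ => _) = (fun x => expR (- ln (f x)))).
  by do 2!apply: measurableT_comp => //; exact: measurableT_comp.
by apply/funext => x; rewrite expRN lnK// posrE.
Qed.

(** The closed formulas build the density from measurable functions of one variable; D > 0 justifies
    both the formula for K and the inverse in it. *)
Lemma measurable_tens_curvature_density m n
    (F F' F'' : R -> 'rV[R]_m) (G G' G'' : R -> 'rV[R]_n) :
  is_derive_row F F' -> is_derive_row F' F'' ->
  is_derive_row G G' -> is_derive_row G' G'' ->
  measurable_row F'' -> measurable_row G'' ->
  (forall t1 t2,
    0 < gram_det (F' t1 *t G t2 : 'rV_(m * n)) (F t1 *t G' t2 : 'rV_(m * n))) ->
  measurable_fun [set: R * R] (abs_curvature_density (tens_surface F G)).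
Proof.
move=> dF dF' dG dG' mF'' mG'' D0.
have mF := is_derive_row_measurable dF; have mF' := is_derive_row_measurable dF'.
have mG := is_derive_row_measurable dG; have mG' := is_derive_row_measurable dG'.
have m1 (f : R -> R) : measurable_fun setT f ->
    measurable_fun [set: R * R] (fun t => f t.1).
  by move=> mf; exact: measurableT_comp mf measurable_fst.
have m2 (f : R -> R) : measurable_fun setT f ->
    measurable_fun [set: R * R] (fun t => f t.2).
  by move=> mf; exact: measurableT_comp mf measurable_snd.
pose D (t : R * R) :=
  gram_det (F' t.1 *t G t.2 : 'rV_(m * n)) (F t.1 *t G' t.2 : 'rV_(m * n)).
have mD : measurable_fun setT D.
  rewrite /D; under eq_fun do rewrite gram_det_tens.
  apply: measurable_funB; apply: measurable_funM.
  - exact: (m1 _ (measurable_funM (measurable_dotv mF mF) (measurable_dotv mF' mF'))).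
  - exact: (m2 _ (measurable_funM (measurable_dotv mG mG) (measurable_dotv mG' mG'))).
  - exact: (m1 _ (measurable_funX 2 (measurable_dotv mF mF'))).
  - exact: (m2 _ (measurable_funX 2 (measurable_dotv mG mG'))).
apply/measurable_EFinP; apply: measurable_funM; last first.
  under eq_fun do rewrite (area_density_tens _ _ dF dG).
  apply: (measurableT_comp (f := @Num.sqrt R)) mD.
  by apply: continuous_measurable_fun; exact: sqrt_continuous.
apply: measurableT_comp; first exact: normr_measurable.
under eq_fun do rewrite (gauss_curvature_tens dF dF' dG dG' (D0 _ _)).
apply: measurable_funM; last first.
  apply: measurable_fun_inv_gt0 => [t|]; first by rewrite exprn_gt0// D0.
  exact: measurable_funX.
apply: measurable_funB; apply: measurable_funM.
- apply: measurable_funM; last exact: (m1 _ (measurable_bivector_dot mF mF' mF'')).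
  by apply: measurable_funM; [exact: (m1 _ (measurable_dotv mF mF))|
    exact: (m2 _ (measurable_dotv mG mG))].
- exact: (m2 _ (measurable_bivector_dot mG mG' mG'')).
- apply: measurable_funM; last exact: (m1 _ (measurable_gram_det mF mF')).
  by apply: measurable_funM; [exact: (m1 _ (measurable_dotv mF' mF'))|
    exact: (m2 _ (measurable_dotv mG' mG'))].
- exact: (m2 _ (measurable_gram_det mG mG')).
Qed.

(** * Integrability of exponentially decaying functions on the plane *)

Lemma continuous_expR_Nabs (eps : R) : continuous (fun x : R => expR (- eps * `|x|)).
Proof.
move=> x; apply: continuous_comp; last exact: continuous_expR.
by apply: cvgM; [exact: cvg_cst|exact: norm_continuous].
Qed.

(** By symmetry the half-line is enough, where the integrand is 1 / eps times the exponential
    density, of total mass 1. *)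
Lemma integral_expR_Nabs_lty (eps : R) : 0 < eps ->
  (\int[@lebesgue_measure R]_x (expR (- eps * `|x|))%:E < +oo)%E.
Proof.
move=> eps0; rewrite ge0_symfun_integralT.
- apply: lte_mul_pinfty => //.
  have mpos : measurable [set x : R | 0 <= x] by rewrite -set_itvcy.
  have mpdf : measurable_fun [set: R] (fun x => (exponential_pdf eps x)%:E).
    by apply/measurable_EFinP; apply: measurable_exponential_pdf.
  have pdf_ge0 x : (0 <= (exponential_pdf eps x)%:E)%E.
    by rewrite lee_fin exponential_pdf_ge0// ltW.
  have pdfE (x : R) : 0 <= x ->
      (expR (- eps * `|x|))%:E = (eps^-1%:E * (exponential_pdf eps x)%:E)%E.
    by move=> x0; rewrite exponential_pdfE// -EFinM mulKf ?gt_eqF// ger0_norm.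
  under eq_integral => x x0 do rewrite (pdfE x (set_mem x0)).
  rewrite ge0_integralZl//; last 2 first.
  + exact: measurable_funTS.
  + by rewrite lee_fin invr_ge0 ltW.
  apply: lte_mul_pinfty => //; first by rewrite lee_fin invr_ge0 ltW.
  apply: (@le_lt_trans _ _ 1%E); last exact: ltry.
  rewrite -(integral_exponential_pdf eps0).
  exact: ge0_subset_integral.
- by move=> x; exact: expR_ge0.
- exact: continuous_expR_Nabs.
- by move=> x /=; rewrite normrN.
Qed.

(** With the sum |t1| + |t2| in the exponent the majorant is a product, and Tonelli reduces it to
    one-variable integrals. *)
Lemma integral2_lty (f : R * R -> \bar R) (eps C : R) : 0 < eps -> 0 <= C ->
  measurable_fun [set: R * R] f -> (forall t, 0 <= f t)%E ->
  (forall t, f t <= (C * expR (- eps * (`|t.1| + `|t.2|)))%:E)%E ->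
  (\int[(@lebesgue_measure R \x @lebesgue_measure R)%E]_(t in setT) f t < +oo)%E.
Proof.
move=> eps0 C0 mf f0 fC; pose E (x : R) := expR (- eps * `|x|).
have mE : measurable_fun [set: R] E.
  by apply: continuous_measurable_fun; exact: continuous_expR_Nabs.
pose g (t : R * R) := ((C * E t.1)%:E * (E t.2)%:E)%E.
have mg : measurable_fun [set: R * R] g.
  apply/measurable_EFinP; apply: measurable_funM; last first.
    exact: measurableT_comp mE measurable_snd.
  by apply: measurable_funM => //; exact: measurableT_comp mE measurable_fst.
have E0 x : 0 <= E x by exact: expR_ge0.
have g0 t : (0 <= g t)%E by rewrite mule_ge0// lee_fin// mulr_ge0.
apply: (@le_lt_trans _ _
    (\int[(@lebesgue_measure R \x @lebesgue_measure R)%E]_(t in setT) g t)%E).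
  apply: ge0_le_integral => // t _; rewrite (le_trans (fC t))//.
  by rewrite /g -EFinM lee_fin -mulrA /E -expRD mulrDr.
rewrite fubini_tonelli1// /fubini_F /g/=.
under eq_integral => x _.
  rewrite ge0_integralZl//; last 3 first.
  - exact/measurable_EFinP.
  - by move=> y _; rewrite lee_fin.
  - by rewrite lee_fin mulr_ge0.
  over.
rewrite ge0_integralZr//; last 3 first.
- by apply/measurable_EFinP; exact: measurable_funM.
- by move=> x _; rewrite lee_fin mulr_ge0.
- by apply: integral_ge0 => y _; rewrite lee_fin.
have I_fin : (\int[@lebesgue_measure R]_y (E y)%:E)%E \is a fin_num.
  rewrite ge0_fin_numE ?integral_expR_Nabs_lty//.
  by apply: integral_ge0 => y _; rewrite lee_fin.
under eq_integral do rewrite EFinM.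
rewrite ge0_integralZl//; last 2 first.
- exact/measurable_EFinP.
- by move=> y _; rewrite lee_fin.
by rewrite -(fineK I_fin) -!EFinM ltry.
Qed.

End Measurability.

(** * Comparison with the Euclidean norm and conclusion *)

Lemma norm2_le {R : realType} (t1 t2 : R) : norm2 t1 t2 <= `|t1| + `|t2|.
Proof.
rewrite /norm2 -(@ger0_norm _ (`|t1| + `|t2|)) ?addr_ge0// -sqrtr_sqr ler_wsqrtr//.
rewrite sqrrD !real_normK ?num_real// addrAC lerDl.
by rewrite mulrn_wge0// mulr_ge0.
Qed.

Unset Implicit Arguments.
Set Strict Implicit.
Set Printing Implicit Defensive.

Theorem theorem1p8 (R : realType) (n1 n2 : nat)
    (c1 : 'I_n1 -> R) (c2 : 'I_n2 -> R)
    (rs1 rs2 : seq R) (zs1 zs2 : seq (R * R))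
    (hn1 : (2 <= n1)%N) (hn2 : (2 <= n2)%N)
    (simple1 : simple_roots c1) (simple2 : simple_roots c2)
    (roots1 : lists_roots c1 rs1 zs1) (roots2 : lists_roots c2 rs2 zs2)
    (dom1 : dominant_real_roots c1 rs1) (dom2 : dominant_real_roots c2 rs2) :
  let Sigma := tensor_surface n1 n2 rs1 zs1 rs2 zs2 in
  let K := gauss_curvature Sigma in
  let g := area_density Sigma in
  (exists eps C : R,
    [/\ 0 < eps, 0 < C &
      forall t1 t2 : R,
        `|K t1 t2| <= C * expR (- eps * norm2 t1 t2) /\
        g t1 t2 * `|K t1 t2| <= C * expR (- eps * norm2 t1 t2)])
  /\ (measurable_fun [set: R * R] (abs_curvature_density Sigma) /\
      (total_abs_curvature Sigma < +oo)%E).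
Proof.
move=> Sigma K g.
have [F' [F'' [F3 [M1 [eta1 [h1 [dF dF' dF'' HF]]]]]]] := sigma_growth_bounds roots1 dom1.
have [G' [G'' [G3 [M2 [eta2 [h2 [dG dG' dG'' HG]]]]]]] := sigma_growth_bounds roots2 dom2.
have [eps [C [eps0 C0 KC]]] := tens_surface_curvature_decay dF dF' dG dG' HF HG.
have mdens : measurable_fun [set: R * R] (abs_curvature_density Sigma).
  apply: (measurable_tens_curvature_density dF dF' dG dG').
  - exact: is_derive_row_measurable dF''.
  - exact: is_derive_row_measurable dG''.
  - by move=> t1 t2; exact: tens_surface_gram_det_gt0 HF HG.
split; last split=> //.
- exists eps, C; split => // t1 t2; have [K1 K2] := KC t1 t2.
  have le_norm : C * expR (- eps * (`|t1| + `|t2|)) <= C * expR (- eps * norm2 t1 t2).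
    rewrite ler_wpM2l ?(ltW C0)// ler_expR !mulNr lerN2.
    by rewrite ler_wpM2l ?(ltW eps0)// norm2_le.
  by split; [exact: le_trans K1 le_norm|exact: le_trans K2 le_norm].
(* Integrability uses the bound by |t1| + |t2| directly, before its weakening to the Euclidean
   norm. *)
apply: (integral2_lty eps0 (ltW C0)) => //.
- by move=> t; rewrite lee_fin mulr_ge0// sqrtr_ge0.
- by move=> t; rewrite lee_fin mulrC; case: (KC t.1 t.2).
Qed.
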